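(* Let $\mathcal{L}=(L,\leq)$ be a finite congruence-uniform lattice. If the core label order $\mathrm{CLO}(\mathcal{L})$ is a lattice, then $\mathcal{L}$ is spherical.
   Context: For a finite lattice $\mathcal{L}=(L,\leq)$, $\mathcal{J}(\mathcal{L})$ denotes the set of join-irreducible elements (elements $j\neq\hat{0}$ such that $j=x\vee y$ implies $j\in\{x,y\}$); each such $j$ has a unique lower cover $j_{*}$. For a cover relation $u\lessdot v$, $\mathrm{cg}(u,v)$ is the finest lattice congruence of $\mathcal{L}$ in which $u$ and $v$ are equivalent, and $\mathrm{cg}(j)=\mathrm{cg}(j_*,j)$. The join-irreducible elements of the congruence lattice $\mathrm{Con}(\mathcal{L})$ are exactly the congruences $\mathrm{cg}(j)$, $j\in\mathcal{J}(\mathcal{L})$. A finite lattice is congruence-uniform if the map $j\mapsto\mathrm{cg}(j)$ is a bijection from $\mathcal{J}(\mathcal{L})$ onto the join-irreducible congruences, both for $\mathcal{L}$ and for its dual $(L,\geq)$. In a congruence-uniform lattice, for a cover $u\lessdot v$ let $j_{\mathrm{cg}(u,v)}$ be the unique $j\in\mathcal{J}(\mathcal{L})$ with $\mathrm{cg}(j)=\mathrm{cg}(u,v)$. The nucleus of $x\in L$ is $x_{\downarrow}=\bigwedge\{y\in L\mid y\lessdot x\}$ (for $x=\hat{0}$ the core label set below is empty). The core label set of $x$ is $\Psi(x)=\{j_{\mathrm{cg}(u,v)}\mid x_{\downarrow}\leq u\lessdot v\leq x\}$. The core label order is $\mathrm{CLO}(\mathcal{L})=(L,\sqsubseteq)$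 where $x\sqsubseteq y$ iff $\Psi(x)\subseteq\Psi(y)$; this is a partial order. A bounded poset is spherical if the order complex of its proper part (the poset with $\hat0$ and $\hat1$ removed) is homotopy equivalent to a sphere. *)

(* Defs.v *)
From HB Require Import structures.
From mathcomp Require Import all_boot all_order all_algebra.

Set Implicit Arguments.
Unset Strict Implicit.
Unset Printing Implicit Defensive.

Import Order.TTheory.

Section Covers.
Local Open Scope order_scope.
Context (d : Order.disp_t) (P : finPOrderType d).

Definition covers (u v : P) : bool :=
  (u < v) && ~~ [exists w : P, (u < w) && (w < v)].

End Covers.

Section Congruences.
Local Open Scope order_scope.
Context (d : Order.disp_t) (L : finTBLatticeType d).

Definition join_irreducible (j : L) : bool :=
  (j != \bot) && [forall x : L, forall y : L,
    (j == x `|` y) ==> ((j == x) || (j == y))].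

(* When [j] is join-irreducible it has exactly one lower cover, so the choice
   made by [pick] is forced and the default value is not used; see
   [join_irreducible_covers] below. *)
Definition lower_cover (j : L) : L := odflt j [pick u | covers u j].

Definition congruence (R : {set L * L}) : bool :=
  [&& [forall x : L, (x, x) \in R],
      [forall x : L, forall y : L, ((x, y) \in R) ==> ((y, x) \in R)],
      [forall x : L, forall y : L, forall z : L,
        ((x, y) \in R) && ((y, z) \in R) ==> ((x, z) \in R)] &
      [forall x : L, forall x' : L, forall y : L, forall y' : L,
        ((x, x') \in R) && ((y, y') \in R) ==>
        ((x `&` y, x' `&` y') \in R) && ((x `|` y, x' `|` y') \in R)]].

Definition congruence_generated (A : {set L * L}) : {set L * L} :=
  \bigcap_(R : {set L * L} | congruence R && (A \subset R)) R.

Definition cg (u v : L) : {set L * L} := congruence_generated [set (u, v)].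

Definition cg_irr (j : L) : {set L * L} := cg (lower_cover j) j.

(* Join-irreducible elements of Con(L): its least element is the equality
   relation, and the join of two congruences is generated by their union. *)
Definition join_irreducible_congruence (R : {set L * L}) : bool :=
  [&& congruence R, R != [set p | p.1 == p.2] &
      [forall S : {set L * L}, forall T : {set L * L},
        [&& congruence S, congruence T & R == congruence_generated (S :|: T)]
        ==> ((R == S) || (R == T))]].

Definition cg_irr_bijective : Prop :=
  {in [set j | join_irreducible j] &, injective cg_irr} /\
  cg_irr @: [set j | join_irreducible j] =
    [set R | join_irreducible_congruence R].

End Congruences.

Section LowerCover.
Local Open Scope order_scope.
Context (d : Order.disp_t) (L : finTBLatticeType d).

Lemma covers_above (x y : L) : x < y -> exists2 u, covers u y & x <= u.
Proof.
move=> xy; pose B z := [set w : L | (z < w) && (w < y)].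
have [n] := ubnP #|B x|; elim: n x xy => // n IH x xy; rewrite ltnS => le_n.
have [/existsP[w /andP[xw wy]]|nw] := boolP [exists w, (x < w) && (w < y)].
  have [|u uy wu] := IH w wy; last first.
    by exists u => //; apply: le_trans wu; apply: ltW.
  apply: leq_trans le_n; apply: proper_card; apply/properP; split.
    apply/subsetP => z; rewrite !inE => /andP[wz ->]; rewrite andbT.
    exact: lt_trans wz.
  by exists w; rewrite !inE ?xw ?wy ?ltxx.
by exists x => //; rewrite /covers xy nw.
Qed.

Lemma join_irreducible_covers (j u : L) :
  join_irreducible j -> covers u j = (u == lower_cover j).
Proof.
move=> /andP[j0 /forallP jP]; rewrite /lower_cover.
case: pickP => [v vj|none] /=; last first.
  by have [|w] := @covers_above \bot j; rewrite ?lt0x // none.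
have cu (w w' : L) : covers w j -> covers w' j -> w <= w'.
  move=> /andP[wj _] /andP[w'j nw'].
  have: w `|` w' <= j by rewrite leUx !ltW.
  rewrite le_eqVlt => /orP[/eqP e|lt].
    have /forallP/(_ w') := jP w; rewrite e eqxx /= => /orP[] /eqP e'.
      by rewrite e' ltxx in wj.
    by rewrite e' ltxx in w'j.
  have := leUr w' w; rewrite le_eqVlt => /orP[/eqP ->|lt']; first exact: leUl.
  by case/negP: nw'; apply/existsP; exists (w `|` w'); rewrite lt'.
apply/idP/eqP => [uj|-> //]; apply: le_anti; rewrite !cu //.
Qed.

End LowerCover.

Definition congruence_uniform (d : Order.disp_t) (L : finTBLatticeType d) :=
  cg_irr_bijective L /\ cg_irr_bijective L^d.

Section CoreLabelOrder.
Local Open Scope order_scope.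
Context (d : Order.disp_t) (L : finTBLatticeType d).

(* [nucleus \bot] is the empty meet [\top]; then no cover [u], [v] satisfies
   [nucleus \bot <= u] and [v <= \bot], so that [core_labels \bot] is empty. *)
Definition nucleus (x : L) : L := \meet_(y : L | covers y x) y.

Definition core_labels (x : L) : {set L} :=
  [set j : L | join_irreducible j && [exists u : L, exists v : L,
    [&& nucleus x <= u, covers u v, v <= x & cg_irr j == cg u v]]].

Definition clo (x y : L) : bool := core_labels x \subset core_labels y.

End CoreLabelOrder.

Definition is_meet (T : Type) (le : rel T) (x y m : T) : Prop :=
  [/\ le m x, le m y & forall z, le z x -> le z y -> le z m].

Definition is_join (T : Type) (le : rel T) (x y m : T) : Prop :=
  [/\ le x m, le y m & forall z, le x z -> le y z -> le m z].

(* The order axioms are not part of this predicate: [clo] is reflexive and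
   transitive by definition, and it is antisymmetric when [L] is
   congruence-uniform. *)
Definition is_lattice (T : Type) (le : rel T) : Prop :=
  forall x y, (exists m, is_meet le x y m) /\ (exists m, is_join le x y m).

Section OrderComplex.
Local Open Scope order_scope.
Context (d : Order.disp_t).

Definition proper_part (P : finTBPOrderType d) : {set P} :=
  [set x | (x != \bot) && (x != \top)].

(* The nonempty chains contained in [A]. *)
Definition order_complex (P : finPOrderType d) (A : {set P}) :
    {set {set P}} :=
  [set C : {set P} | [&& C != set0, C \subset A &
    [forall x in C, forall y in C, (x <= y) || (y <= x)]]].

End OrderComplex.

From mathcomp Require Import all_classical all_reals all_analysis.
Import GRing.Theory Num.Theory numFieldNormedType.Exports.

Section Homotopy.
Local Open Scope ring_scope.
Local Open Scope classical_set_scope.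
Context (R : realType).

(* Subsets [A] and [B] carry the subspace topology, and maps from [A] to [B]
   are represented by total functions considered on [A] only. *)
Definition homotopic (X Y : topologicalType) (A : set X) (B : set Y)
    (f g : X -> Y) : Prop :=
  exists H : X * R -> Y,
    [/\ {within A `*` `[0, 1], continuous H},
        set_fun (A `*` `[0, 1]) B H,
        (forall x, A x -> H (x, 0) = f x) &
        (forall x, A x -> H (x, 1) = g x)].

Definition homotopy_equivalent (X Y : topologicalType)
    (A : set X) (B : set Y) : Prop :=
  exists (f : X -> Y) (g : Y -> X),
    [/\ {within A, continuous f} /\ set_fun A B f,
        {within B, continuous g} /\ set_fun B A g,
        homotopic A A (g \o f) id &
        homotopic B B (f \o g) id].

(* Barycentric coordinates; the index set is finite, so pointwise convergence
   is the Euclidean topology. *)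
Definition geometric_realization (T : finType) (K : {set {set T}}) :
    set {ptws T -> R} :=
  [set t : {ptws T -> R} | [/\ forall x, 0 <= t x, \sum_x t x = 1 &
    [set x | t x != 0]%SET \in K]].

(* The unit sphere of R^n, of dimension n - 1; it is empty for n = 0. *)
Definition unit_sphere (n : nat) : set 'rV[R]_n :=
  [set v | \sum_i v ord0 i ^+ 2 = 1].

Definition spherical (d : Order.disp_t) (P : finTBPOrderType d) : Prop :=
  exists n : nat, homotopy_equivalent
    (geometric_realization (order_complex (proper_part P))) (@unit_sphere n).

End Homotopy.

(* Main.v *)
(* In a congruence-uniform lattice the label of a cover [u], [v] is the least
   element below [v] and not below [u]; hence a core label of [x] lies below [x]
   but not below the nucleus of [x]. If the core label order is a lattice, it has
   a greatest element [t], and every join-irreducible is a core label of [t]. This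
   forces [t = \top] and [nucleus t = \bot], that is, the coatoms meet to [\bot].
   Labels also show that a meet of coatoms lies below a coatom [c] only if [c] is
   one of them.

   Therefore [x |-> {c | c is a coatom not above x}] belongs to a Galois connection
   between the lattice and the Boolean lattice of sets of coatoms, which restricts
   to the proper parts and makes their order complexes homotopy equivalent. For
   the Boolean lattice, a nonconstant function on the coatoms determines the chain
   of its superlevel sets, and a point of the order complex determines a function
   whose superlevel sets contain the chain carrying it; modulo constants and
   positive scaling, the nonconstant functions form a sphere. *)

Require Import Defs.
From mathcomp Require Import all_boot all_order all_algebra lra.
From mathcomp Require Import all_classical all_reals all_analysis.

Set Implicit Arguments.
Unset Strict Implicit.
Unset Printing Implicit Defensive.

Import Order.TTheory Order.DefaultSetSubsetOrder.
Import GRing.Theory Num.Theory numFieldNormedType.Exports.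

(** * Congruence labels in a finite lattice *)

Lemma exists_minimal (d : Order.disp_t) (P : finPOrderType d) (Q : pred P) (x : P) :
  Q x -> exists m, [/\ Q m, (m <= x)%O & forall y, (y < m)%O -> ~~ Q y].
Proof.
move=> Qx; pose below m := [pred y : P | (y <= m)%O].
have Qx_le : Q x && (x <= x)%O by rewrite Qx lexx.
have [m /andP[Qm mx] m_min] :=
  arg_minnP (P := fun y => Q y && (y <= x)%O) (fun y => #|below y|) Qx_le.
exists m; split=> // y ym; apply/negP => Qy.
have := m_min y; rewrite Qy (le_trans (ltW ym) mx) => /(_ isT).
rewrite leqNgt => /negP[]; apply: proper_card; apply/properP; split.
  by apply/fintype.subsetP => z; rewrite !inE => zy; apply: le_trans zy (ltW ym).
by exists m; rewrite !inE ?lexx // lt_geF.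
Qed.

Lemma lattice_has_top (T : finType) (le : rel T) (x0 : T) :
  reflexive le -> transitive le -> is_lattice le -> exists t, forall x, le x t.
Proof.
move=> le_refl le_tr lat.
suff [t t_ge] : exists t, forall x, x \in enum T -> le x t.
  by exists t => x; apply: t_ge; rewrite mem_enum.
elim: (enum T) => [|y s [t t_ge]]; first by exists x0.
have [_ [m [ym tm _]]] := lat y t; exists m => x; rewrite inE.
by case/predU1P => [->//|/t_ge xt]; apply: le_tr xt tm.
Qed.

Section Congruences.
Local Open Scope order_scope.
Context (d : Order.disp_t) (L : finTBLatticeType d).
Implicit Types (u v j x y : L) (R : {set L * L}).

Lemma congruenceP R : reflect
  [/\ forall x, (x, x) \in R,
      forall x y, (x, y) \in R -> (y, x) \in R,
      forall x y z, (x, y) \in R -> (y, z) \in R -> (x, z) \in R &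
      forall x x' y y', (x, x') \in R -> (y, y') \in R ->
        (x `&` y, x' `&` y') \in R /\ (x `|` y, x' `|` y') \in R]
  (congruence R).
Proof.
apply: (iffP and4P) => -[Rrefl Rsym Rtrans Rmj]; split.
- by move=> x; apply: (forallP Rrefl).
- by move=> x y; move/forallP/(_ x)/forallP/(_ y)/implyP: Rsym.
- move=> x y z xy yz; move/forallP/(_ x)/forallP/(_ y)/forallP/(_ z): Rtrans.
  by rewrite xy yz.
- move=> x x' y y' xx yy; move/forallP/(_ x)/forallP/(_ x'): Rmj.
  by move/forallP/(_ y)/forallP/(_ y'); rewrite xx yy => /andP.
- exact/forallP.
- by apply/forallP => x; apply/forallP => y; apply/implyP/Rsym.
- apply/forallP => x; apply/forallP => y; apply/forallP => z.
  by apply/implyP => /andP[]; apply: Rtrans.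
- apply/forallP => x; apply/forallP => x'; apply/forallP => y; apply/forallP => y'.
  by apply/implyP => /andP[xx yy]; apply/andP/Rmj.
Qed.

Lemma mem_congruence_generated (A : {set L * L}) p :
  reflect (forall R, congruence R -> A \subset R -> p \in R)
    (p \in congruence_generated A).
Proof.
apply: (iffP finset.bigcapP) => [in_all R cR AR|in_all R /andP[]]; last exact: in_all.
by apply: in_all; rewrite cR.
Qed.

Lemma congruence_congruence_generated (A : {set L * L}) :
  congruence (congruence_generated A).
Proof.
apply/congruenceP; split=> [x|x y|x y z|x x' y y'].
- by apply/mem_congruence_generated => R /congruenceP[].
- move/mem_congruence_generated => xy; apply/mem_congruence_generated => R cR AR.
  by have /congruenceP[_ Rsym _ _] := cR; apply/Rsym/xy.
- move=> /mem_congruence_generated xy /mem_congruence_generated yz.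
  apply/mem_congruence_generated => R cR AR.
  by have /congruenceP[_ _ Rtrans _] := cR; apply: Rtrans (xy R _ _) (yz R _ _).
- move=> /mem_congruence_generated xx /mem_congruence_generated yy.
  have R_mj R : congruence R -> A \subset R ->
      (x `&` y, x' `&` y') \in R /\ (x `|` y, x' `|` y') \in R.
    by move=> cR AR; have /congruenceP[_ _ _] := cR; apply; [apply: xx|apply: yy].
  by split; apply/mem_congruence_generated => R cR AR; have [] := R_mj R cR AR.
Qed.

Lemma mem_cg u v : (u, v) \in cg u v.
Proof. by apply/mem_congruence_generated => R _; rewrite finset.sub1set. Qed.

Lemma cg_sub u v R : congruence R -> (u, v) \in R -> cg u v \subset R.
Proof.
move=> cR uvR; apply/fintype.subsetP => p /mem_congruence_generated; apply=> //.
by rewrite finset.sub1set.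
Qed.

Lemma cg_perspective x v : cg (x `&` v) v = cg x (x `|` v).
Proof.
apply/eqP; rewrite finset.eqEsubset; apply/andP.
split; apply: cg_sub; rewrite ?congruence_congruence_generated //.
  have /congruenceP[cg_refl _ _ cg_mj] :=
    congruence_congruence_generated [set (x, x `|` v)].
  have [+ _] := cg_mj _ _ _ _ (mem_cg x (x `|` v)) (cg_refl v).
  by rewrite (meet_r (leUr v x)).
have /congruenceP[cg_refl _ _ cg_mj] :=
  congruence_congruence_generated [set (x `&` v, v)].
have [_] := cg_mj _ _ _ _ (cg_refl x) (mem_cg (x `&` v) v).
by rewrite meetKU.
Qed.

Lemma covers_between u v x : covers u v -> u <= x -> x <= v -> x = u \/ x = v.
Proof.
case/andP=> _ /existsPn/(_ x); rewrite !lt_neqAle => + ux xv.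
by rewrite ux xv !andbT negb_and !negbK => /orP[]/eqP; [left|right].
Qed.

Lemma join_irreducible_separation x y : ~~ (x <= y) ->
  exists j, [/\ join_irreducible j, j <= x, ~~ (j <= y) & lower_cover j <= y].
Proof.
move=> xy; have [j [jy jx jmin]] := exists_minimal (Q := fun z => ~~ (z <= y)) xy.
have lt_j z : z < j -> z <= y by move/jmin; rewrite negbK.
have ji : join_irreducible j.
  apply/andP; split; first by apply: contraNneq jy => ->; rewrite le0x.
  apply/forallP => w; apply/forallP => z; apply/implyP => /eqP j_wz.
  apply: contraNT jy; rewrite negb_or => /andP[jw jz].
  by rewrite j_wz leUx !lt_j // lt_neqAle eq_sym ?jw ?jz j_wz ?leUl ?leUr.
exists j; split=> //; apply: lt_j.
by have: covers (lower_cover j) j; [rewrite join_irreducible_covers|case/andP].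
Qed.

(* In a congruence-uniform lattice [is_label j u v] characterises
   [j = j_cg(u,v)]. *)
Definition is_label j u v : bool := join_irreducible j && (cg_irr j == cg u v).

Lemma exists_label u v x : covers u v -> x <= v -> ~~ (x <= u) ->
  exists j, [/\ is_label j u v, j <= x & ~~ (j <= u)].
Proof.
move=> uv xv /join_irreducible_separation[j [ji jx ju lju]].
exists j; split=> //; rewrite /is_label ji; apply/eqP.
have cov_j : covers (lower_cover j) j by rewrite join_irreducible_covers.
have /andP[lj _] := cov_j; have /andP[u_lt_v _] := uv.
have meet_uj : u `&` j = lower_cover j.
  have [||//|ujj] := covers_between cov_j (x := u `&` j).
  - by rewrite lexI lju ltW.
  - exact: leIr.
  - by rewrite -ujj leIl in ju.
have join_uj : u `|` j = v.
  have [||uju|//] := covers_between uv (x := u `|` j).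
  - exact: leUl.
  - by rewrite leUx (ltW u_lt_v) (le_trans jx xv).
  - by rewrite -uju leUr in ju.
by rewrite /cg_irr -meet_uj cg_perspective join_uj.
Qed.

Lemma join_irreducible_core_label j : join_irreducible j -> j \in core_labels j.
Proof.
move=> ji; have cov_j : covers (lower_cover j) j by rewrite join_irreducible_covers.
rewrite inE ji; apply/existsP; exists (lower_cover j); apply/existsP; exists j.
by rewrite cov_j lexx eqxx !andbT; apply: meets_inf.
Qed.

End Congruences.

Section CongruenceUniform.
Local Open Scope order_scope.
Context (d : Order.disp_t) (L : finTBLatticeType d).
Implicit Types (u v j x y : L).

Hypothesis cg_irr_inj : {in [set j | join_irreducible j] &, injective (@cg_irr d L)}.

Lemma label_leE u v j x :
  covers u v -> is_label j u v -> x <= v -> (j <= x) = ~~ (x <= u).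
Proof.
move=> uv /andP[ji /eqP jE].
have j_below y : y <= v -> ~~ (y <= u) -> j <= y /\ ~~ (j <= u).
  move=> yv /(exists_label uv yv)[k [/andP[ki /eqP kE] ky ku]].
  by rewrite (cg_irr_inj _ _ (etrans jE (esym kE))) ?inE.
move=> xv; apply/idP/idP => [jx|/(j_below x xv)[]//].
have [|_] := j_below v (lexx v); first by case/andP: uv => /lt_geF->.
exact/contra/le_trans.
Qed.

Lemma core_label_bounds x j : j \in core_labels x -> j <= x /\ ~~ (j <= nucleus x).
Proof.
rewrite inE => /andP[ji /existsP[u /existsP[v /and4P[nu uv vx jE]]]].
have j_label : is_label j u v by rewrite /is_label ji.
have /andP[u_lt_v _] := uv; split.
  by apply: le_trans vx; rewrite (label_leE uv) // lt_geF.
apply/negP => /le_trans/(_ nu).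
by rewrite (label_leE uv j_label (ltW u_lt_v)) lexx.
Qed.

Lemma nucleus_top : is_lattice (@clo d L) -> nucleus (\top : L) = \bot.
Proof.
move=> clo_lattice; have [||t t_max] := lattice_has_top \bot _ _ clo_lattice.
- by move=> x; apply: subxx.
- by move=> x y z; apply: fintype.subset_trans.
have ji_bounds j : join_irreducible j -> j <= t /\ ~~ (j <= nucleus t).
  move=> /join_irreducible_core_label j_core; apply: core_label_bounds.
  exact: (fintype.subsetP (t_max j)).
have t_top : t = \top.
  apply/eqP; rewrite -le1x; apply/negPn/negP.
  by move=> /join_irreducible_separation[j [/ji_bounds[-> _]]].
apply/eqP; rewrite -lex0 -t_top; apply/negPn/negP.
by move=> /join_irreducible_separation[j [/ji_bounds[_ /negP]]].
Qed.

Lemma coatoms_meet_le (S : {set L}) (c : L) :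
  {in S, forall k, covers k \top} -> covers c \top ->
  (\meet_(k in S) k <= c) = (c \in S).
Proof.
move=> S_coatoms c_coatom; apply/idP/idP => [|cS]; last exact: meets_inf.
have c_lt1 : ~~ (\top <= c) by case/andP: c_coatom => /lt_geF->.
apply: contraTT => cS.
have [j [j_label _ jc]] := exists_label c_coatom (lexx _) c_lt1.
apply: contra jc; apply: le_trans; apply/meetsP => k kS.
rewrite (label_leE c_coatom j_label (lex1 k)); apply/negP => kc.
have [ck|c1] := covers_between (S_coatoms k kS) kc (lex1 c).
  by rewrite ck kS in cS.
by rewrite c1 lexx in c_lt1.
Qed.

End CongruenceUniform.

(** * Homotopies between subsets of topological spaces *)

Section Homotopies.
Local Open Scope ring_scope.
Local Open Scope classical_set_scope.
Context {R : realType}.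
Implicit Types (X Y Z : topologicalType).

Definition continuous_map X Y (A : set X) (B : set Y) (f : X -> Y) : Prop :=
  {within A, continuous f} /\ set_fun A B f.

Definition cylinder X (A : set X) : set (X * R) := A `*` `[0, 1].

Lemma continuous_map_comp X Y Z (A : set X) (B : set Y) (C : set Z)
    (f : X -> Y) (g : Y -> Z) :
  continuous_map A B f -> continuous_map B C g -> continuous_map A C (g \o f).
Proof.
move=> [/subspace_continuousP cf fAB] [/subspace_continuousP cg gBC]; split.
  apply/subspace_continuousP => x Ax; have gfx := cg _ (fAB x Ax).
  apply: cvg_comp gfx => U /= BU.
  have := cf x Ax _ BU.
  apply: filterS2 (withinT A (nbhs_filter x)) => y Ay; apply.
  exact: fAB.
by move=> x /fAB/gBC.
Qed.

Lemma continuous_pair X Y Z (p : X) (f : X -> Y) (g : X -> Z) :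
  {for p, continuous f} -> {for p, continuous g} ->
  {for p, continuous (fun q => (f q, g q))}.
Proof.
move=> cf cg; exact: (@cvg_pair _ _ _ (nbhs p) (nbhs (f p)) (nbhs (g p))).
Qed.

Lemma continuous_if_le X Y (p : X) (a : X -> R) (c : R) (f g : X -> Y) :
  {for p, continuous a} -> {for p, continuous f} -> {for p, continuous g} ->
  (a p = c -> f p = g p) ->
  {for p, continuous (fun q => if a q <= c then f q else g q)}.
Proof.
move=> ca cf cg fg U; rewrite /=; case: ltgtP => [apc|apc|/fg fgp] hU.
- have near_lt : \forall q \near p, a q < c by exact: (cvgr_lt _ ca).
  by apply: filterS2 near_lt (cf U hU) => q /ltW qc; rewrite /= qc.
- have near_gt : \forall q \near p, c < a q by exact: (cvgr_gt _ ca).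
  by apply: filterS2 near_gt (cg U hU) => q /lt_geF qc; rewrite /= qc.
- have gU : nbhs (g p) U by rewrite -fgp.
  have near_f : \forall q \near p, U (f q) := cf U hU.
  have near_g : \forall q \near p, U (g q) := cg U gU.
  by apply: filterS2 near_f near_g => q fq gq; rewrite /=; case: ifP.
Qed.

Lemma continuous_maxr0 X (p : X) (a : X -> R) :
  {for p, continuous a} -> {for p, continuous (fun q => Num.max 0 (a q))}.
Proof. by apply: (@continuous_max _ _ (fun=> 0)); exact: cvg_cst. Qed.

Lemma continuous_map_reparametrize X (A : set X) (phi : R -> R) :
  continuous phi -> (forall a, 0 <= a <= 1 -> 0 <= phi a <= 1) ->
  continuous_map (cylinder A) (cylinder A) (fun p => (p.1, phi p.2)).
Proof.
move=> cphi phi01; split; last first.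
  by move=> [x a] [/= Ax]; rewrite !in_itv /= => /phi01.
apply: continuous_subspaceT => p; apply: continuous_pair; first exact: cvg_fst.
by apply: (@continuous_comp _ _ _ snd phi); [exact: cvg_snd|exact: cphi].
Qed.

Lemma continuous_map_fst X (A : set X) : continuous_map (cylinder A) A fst.
Proof.
by split=> [|p []//]; apply: continuous_subspaceT => p; apply: cvg_fst.
Qed.

Lemma homotopic_refl X Y (A : set X) (B : set Y) (f : X -> Y) :
  continuous_map A B f -> homotopic R A B f f.
Proof.
move=> fAB; exists (f \o fst).
by have [cf fB] := continuous_map_comp (continuous_map_fst A) fAB.
Qed.

Lemma homotopic_sym X Y (A : set X) (B : set Y) (f g : X -> Y) :
  homotopic R A B f g -> homotopic R A B g f.
Proof.
move=> [H [cH HAB H0 H1]].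
have rev_map : continuous_map (cylinder A) (cylinder A)
    (fun p : X * R => (p.1, 1 - p.2)).
  apply: (@continuous_map_reparametrize _ _ (fun a => 1 - a)); last by move=> a; lra.
  by move=> a; apply: cvgB; [exact: cvg_cst|exact: cvg_id].
have [cH' H'AB] := continuous_map_comp rev_map (conj cH HAB).
exists (H \o (fun p : X * R => (p.1, 1 - p.2))); split=> // x Ax /=.
  by rewrite subr0 H1.
by rewrite subrr H0.
Qed.

Definition first_half X (p : X * R) : X * R := (p.1, Num.min 1 (2 * p.2)).

Definition second_half X (p : X * R) : X * R := (p.1, Num.max 0 (2 * p.2 - 1)).

Lemma continuous_map_first_half X (A : set X) :
  continuous_map (cylinder A) (cylinder A) (@first_half X).
Proof.
apply: (@continuous_map_reparametrize _ _ (fun a => Num.min 1 (2 * a))); last first.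
  by move=> a /andP[a0 a1]; rewrite le_min ler01 ge_min lexx mulr_ge0.
move=> a; apply: continuous_min; first exact: cvg_cst.
by apply: cvgM; [exact: cvg_cst|exact: cvg_id].
Qed.

Lemma continuous_map_second_half X (A : set X) :
  continuous_map (cylinder A) (cylinder A) (@second_half X).
Proof.
apply: (@continuous_map_reparametrize _ _ (fun a => Num.max 0 (2 * a - 1))); last first.
  by move=> a /andP[a0 a1]; rewrite le_max lexx ge_max ler01; lra.
move=> a; apply: (@continuous_maxr0 _ _ (fun b : R => 2 * b - 1)).
apply: cvgB; last exact: cvg_cst.
by apply: cvgM; [exact: cvg_cst|exact: cvg_id].
Qed.

Lemma homotopic_trans X Y (A : set X) (B : set Y) (f g h : X -> Y) :
  homotopic R A B f g -> homotopic R A B g h -> homotopic R A B f h.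
Proof.
move=> [F [cF FAB F0 F1]] [G [cG GAB G0 G1]].
have half2 : 2 * (1 / 2) = 1 :> R by rewrite mul1r divff ?pnatr_eq0.
have [cF' F'AB] := continuous_map_comp (continuous_map_first_half A) (conj cF FAB).
have [cG' G'AB] := continuous_map_comp (continuous_map_second_half A) (conj cG GAB).
exists (fun p => if p.2 <= 1 / 2 then F (first_half p) else G (second_half p)); split.
- rewrite continuous_subspace_in => p /set_mem[Ap _].
  apply: (@continuous_if_le (subspace (cylinder A)) _ p snd (1 / 2)
    (F \o @first_half X) (G \o @second_half X)).
  + by apply: continuous_subspaceT => q; apply: cvg_snd.
  + exact: cF'.
  + exact: cG'.
  + move=> p2; rewrite /first_half /second_half /= p2 half2 minxx subrr maxxx.
    by rewrite F1 ?G0.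
- by move=> p Ap /=; case: ifP => _; [exact: F'AB|exact: G'AB].
- move=> x Ax; rewrite ifT /=; last by lra.
  by rewrite /first_half mulr0 (min_r ler01) F0.
- move=> x Ax; rewrite ifF /=; last by apply/negbTE; rewrite -ltNge; lra.
  by rewrite /second_half mulr1 (_ : 2 - 1 = 1) ?(max_r ler01) ?G1 //=; lra.
Qed.

Lemma homotopy_equivalent_set0 X Y (x0 : X) (y0 : Y) :
  homotopy_equivalent R (@set0 X) (@set0 Y).
Proof.
have homotopic0 Z (f g : Z -> Z) : homotopic R set0 set0 f g.
  by exists (f \o fst); rewrite set0X; split=> // p; exact: continuous_subspace0.
exists (fun=> y0), (fun=> x0).
by split=> //; split=> // p; exact: continuous_subspace0.
Qed.

Lemma homotopic_postcomp X Y Z (A : set X) (B : set Y) (C : set Z)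
    (f f' : X -> Y) (g : Y -> Z) :
  continuous_map B C g -> homotopic R A B f f' ->
  homotopic R A C (g \o f) (g \o f').
Proof.
move=> gBC [H [cH HAB H0 H1]]; exists (g \o H).
have [cgH gHAC] := continuous_map_comp (conj cH HAB) gBC.
by split=> // x Ax; rewrite /= ?H0 ?H1.
Qed.

Lemma homotopic_precomp X Y Z (A : set X) (B : set Y) (C : set Z)
    (f : X -> Y) (g g' : Y -> Z) :
  continuous_map A B f -> homotopic R B C g g' ->
  homotopic R A C (g \o f) (g' \o f).
Proof.
move=> fAB [H [cH HBC H0 H1]].
have [cf1 f1B] := continuous_map_comp (continuous_map_fst A) fAB.
have f_id : continuous_map (cylinder A) (cylinder B) (fun p => (f p.1, p.2)).
  split; last by move=> p [Ap1 p2]; split=> //; apply: fAB.2.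
  move=> p; apply: continuous_pair; first exact: cf1.
  by apply: continuous_subspaceT => q; apply: cvg_snd.
have [cHf HfAC] := continuous_map_comp f_id (conj cH HBC).
exists (fun p => H (f p.1, p.2)); split=> // x Ax /=.
  by rewrite H0 //; apply: fAB.2.
by rewrite H1 //; apply: fAB.2.
Qed.

Lemma homotopy_equivalent_trans X Y Z (A : set X) (B : set Y) (C : set Z) :
  homotopy_equivalent R A B -> homotopy_equivalent R B C ->
  homotopy_equivalent R A C.
Proof.
move=> [f [f' [fAB f'BA f'f ff']]] [g [g' [gBC g'CB g'g gg']]].
exists (g \o f), (f' \o g'); split.
- exact: continuous_map_comp gBC.
- exact: continuous_map_comp f'BA.
- apply: homotopic_trans f'f.
  exact: (homotopic_precomp fAB (homotopic_postcomp f'BA g'g)).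
- apply: homotopic_trans gg'.
  exact: (homotopic_precomp g'CB (homotopic_postcomp gBC ff')).
Qed.

End Homotopies.

(** * Geometric realizations and order complexes *)

Local Notation realization R K := (@geometric_realization R _ K).

Section Realization.
Local Open Scope ring_scope.
Local Open Scope classical_set_scope.
Context {R : realType}.
Implicit Types (T U V : finType).

Definition carrier T (t : T -> R) : {set T} := [set x | t x != 0]%SET.

Definition pushforward T U (f : T -> U) (t : {ptws T -> R}) : {ptws U -> R} :=
  fun u => \sum_(x | f x == u) t x.

Lemma continuous_ptws (X : topologicalType) (I : Type) (p : X)
    (f : X -> {ptws I -> R}) :
  (forall i, {for p, continuous (fun q => f q i : R)}) -> {for p, continuous f}.
Proof.
move=> cf; apply/cvg_sup => i W [_ [[/= V oV <-] Vfp] VW].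
by apply: filterS VW _; apply: cf; apply: open_nbhs_nbhs.
Qed.

Lemma continuous_eval (X : topologicalType) (I : eqType) (p : X)
    (f : X -> {ptws I -> R}) i :
  {for p, continuous f} -> {for p, continuous (fun q => f q i : R)}.
Proof.
move=> cf; apply: (@continuous_comp _ _ _ f (fun t : {ptws I -> R} => t i)) => //.
exact: (@proj_continuous I (fun=> R) i).
Qed.

Lemma continuous_sum (X : topologicalType) (I : finType) (Q : pred I) (p : X)
    (f : I -> X -> R) :
  (forall i, Q i -> {for p, continuous (f i)}) ->
  {for p, continuous (fun q => \sum_(i | Q i) f i q)}.
Proof. by move=> cf; apply: cvg_big => //; apply: add_continuous. Qed.

Lemma continuous_prod (X : topologicalType) (I : finType) (Q : pred I) (p : X)
    (f : I -> X -> R) :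
  (forall i, Q i -> {for p, continuous (f i)}) ->
  {for p, continuous (fun q => \prod_(i | Q i) f i q)}.
Proof. by move=> cf; apply: cvg_big => //; apply: mul_continuous. Qed.

Lemma carrier_neq0 T (t : T -> R) : \sum_x t x = 1 -> carrier t != finset.set0.
Proof.
apply: contra_eq_neq => /setP t0; rewrite big1 1?eq_sym ?oner_eq0 // => x _.
by have := t0 x; rewrite !inE => /negbFE/eqP.
Qed.

Lemma carrier_pushforward T U (f : T -> U) (t : {ptws T -> R}) :
  (forall x, 0 <= t x) -> carrier (pushforward f t) = (f @: carrier t)%SET.
Proof.
move=> t0; apply/setP => u; rewrite inE psumr_neq0 //.
apply/hasP/imsetP => [[x _ /andP[/eqP<- tx]]|[x + ->]].
  by exists x; rewrite // inE gt_eqF.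
by rewrite inE => tx; exists x; rewrite ?mem_index_enum // eqxx lt_def tx t0.
Qed.

Lemma pushforward_id T : pushforward id = id :> ({ptws T -> R} -> {ptws T -> R}).
Proof.
by apply: funext => t; apply: funext => x; rewrite /pushforward big_pred1_eq.
Qed.

Lemma pushforward_comp T U V (f : T -> U) (g : U -> V) :
  pushforward (g \o f) = pushforward g \o pushforward f.
Proof.
apply: funext => t; apply: funext => v; rewrite /pushforward /=.
rewrite (partition_big f (fun u => g u == v)) //=; apply: eq_bigr => u /eqP guv.
by apply: eq_bigl => x; rewrite andb_idl // => /eqP->; apply/eqP.
Qed.

Lemma continuous_pushforward T U (f : T -> U) : continuous (pushforward f).
Proof.
move=> t; apply: continuous_ptws => u; apply: continuous_sum => x _.
exact: (@continuous_eval _ _ _ id).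
Qed.

Lemma continuous_map_pushforward T U (K : {set {set T}}) (K' : {set {set U}})
    (f : T -> U) : (forall C, C \in K -> (f @: C)%SET \in K') ->
  continuous_map (realization R K) (realization R K') (pushforward f).
Proof.
move=> fK; split.
  by apply: continuous_subspaceT => t; apply: continuous_pushforward.
move=> t [t0 t1 tK]; split.
- by move=> u; apply: sumr_ge0.
- by rewrite -t1 [RHS](partition_big f predT).
- by rewrite -/(carrier _) carrier_pushforward //; apply: fK.
Qed.

Definition segment (I : Type) (t t' : I -> R) (a : R) : {ptws I -> R} :=
  fun i => (1 - a) * t i + a * t' i.

Lemma segment0 (I : Type) (t t' : I -> R) : segment t t' 0 = t.
Proof. by apply: funext => i; rewrite /segment subr0 mul1r mul0r addr0. Qed.

Lemma segment1 (I : Type) (t t' : I -> R) : segment t t' 1 = t'.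
Proof. by apply: funext => i; rewrite /segment subrr mul0r add0r mul1r. Qed.

Lemma continuous_segment (X : topologicalType) (I : eqType) (p : X)
    (f g : X -> {ptws I -> R}) (a : X -> R) :
  {for p, continuous f} -> {for p, continuous g} -> {for p, continuous a} ->
  {for p, continuous (fun q => segment (f q) (g q) (a q))}.
Proof.
move=> cf cg ca; apply: continuous_ptws => i; apply: cvgD; apply: cvgM => //.
- by apply: cvgB; [exact: cvg_cst|exact: ca].
- exact: continuous_eval.
- exact: continuous_eval.
Qed.

Lemma realization_segment T (K : {set {set T}}) (t t' : {ptws T -> R}) a :
  realization R K t -> realization R K t' -> carrier t :|: carrier t' \in K ->
  0 <= a <= 1 -> realization R K (segment t t' a).
Proof.
move=> tK t'K ttK /andP[a0 a1].
have [->|a_neq0] := eqVneq a 0; first by rewrite segment0.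
have [->|a_neq1] := eqVneq a 1; first by rewrite segment1.
have [[t0 t1 _] [t'0 t'1 _]] := (tK, t'K).
have onem_a_ge0 : 0 <= 1 - a by rewrite subr_ge0.
split; first by move=> x; rewrite addr_ge0 // mulr_ge0.
  by rewrite big_split /= -!mulr_sumr t1 t'1 !mulr1 subrK.
rewrite (_ : [set x | _]%SET = carrier t :|: carrier t') //.
apply/setP => x; rewrite !inE paddr_eq0 ?mulr_ge0 // !mulf_eq0.
by rewrite subr_eq0 (eq_sym 1) (negbTE a_neq0) (negbTE a_neq1) negb_and.
Qed.

Lemma homotopic_segment (X : topologicalType) T (A : set X) (K : {set {set T}})
    (f g : X -> {ptws T -> R}) :
  continuous_map A (realization R K) f -> continuous_map A (realization R K) g ->
  (forall x, A x -> carrier (f x) :|: carrier (g x) \in K) ->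
  homotopic R A (realization R K) f g.
Proof.
move=> fAK gAK fgK; exists (fun p => segment (f p.1) (g p.1) p.2).
have [cf1 _] := continuous_map_comp (@continuous_map_fst R X A) fAK.
have [cg1 _] := continuous_map_comp (@continuous_map_fst R X A) gAK.
split.
- move=> p; apply: (@continuous_segment (subspace (cylinder A)) T p
    (f \o fst) (g \o fst) snd (cf1 p) (cg1 p)).
  by apply: continuous_subspaceT => q; apply: cvg_snd.
- move=> [x a] [/= Ax]; rewrite in_itv /= => a01.
  by apply: realization_segment; [exact: fAK.2|exact: gAK.2|exact: fgK|].
- by move=> x _; apply: segment0.
- by move=> x _; apply: segment1.
Qed.

Lemma homotopic_contiguous T U (K : {set {set T}}) (K' : {set {set U}})
    (f g : T -> U) :
  (forall C, C \in K -> (f @: C)%SET \in K') ->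
  (forall C, C \in K -> (g @: C)%SET \in K') ->
  (forall C, C \in K -> (f @: C)%SET :|: (g @: C)%SET \in K') ->
  homotopic R (realization R K) (realization R K') (pushforward f) (pushforward g).
Proof.
move=> fK gK fgK; apply: homotopic_segment; try exact: continuous_map_pushforward.
by move=> t [t0 _ tK]; rewrite !carrier_pushforward //; apply: fgK.
Qed.

End Realization.

Section OrderComplexes.
Local Open Scope order_scope.

Lemma order_complexP (d : Order.disp_t) (P : finPOrderType d) (A C : {set P}) :
  reflect [/\ C != finset.set0, C \subset A & {in C &, forall x y, x >=< y}]
    (C \in order_complex A).
Proof.
rewrite inE; apply: (iffP and3P) => -[C0 CA C_chain]; split=> //.
  by move=> x y xC yC; move/forall_inP/(_ x xC)/forall_inP: C_chain; apply.
by apply/forall_inP => x xC; apply/forall_inP => y yC; apply: C_chain.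
Qed.

Definition order_map (d d' : Order.disp_t) (P : finPOrderType d)
    (Q : finPOrderType d') (A : {set P}) (B : {set Q}) (f : P -> Q) : Prop :=
  {homo f : x / x \in A >-> x \in B} /\ {in A &, {homo f : x y / x <= y}}.

Lemma order_map_id (d : Order.disp_t) (P : finPOrderType d) (A : {set P}) :
  order_map A A id.
Proof. by split=> [x|x y _ _]. Qed.

Lemma order_map_comp (d d' d'' : Order.disp_t) (P : finPOrderType d)
    (Q : finPOrderType d') (S : finPOrderType d'') (A : {set P}) (B : {set Q})
    (C : {set S}) (f : P -> Q) (g : Q -> S) :
  order_map A B f -> order_map B C g -> order_map A C (g \o f).
Proof.
move=> [fAB f_homo] [gBC g_homo]; split=> [x /fAB/gBC//|x y xA yA xy].
by apply: g_homo; [exact: fAB|exact: fAB|exact: f_homo].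
Qed.

Context {R : realType} (d d' : Order.disp_t).
Context (P : finPOrderType d) (Q : finPOrderType d') (A : {set P}) (B : {set Q}).

Lemma order_map_chain (f : P -> Q) (C : {set P}) :
  order_map A B f -> C \in order_complex A -> f @: C \in order_complex B.
Proof.
move=> [fAB f_homo] /order_complexP[/finset.set0Pn[x xC] /fintype.subsetP CA C_chain].
apply/order_complexP; split.
- by apply/finset.set0Pn; exists (f x); apply: imset_f.
- by apply/fintype.subsetP => _ /imsetP[y /CA yA ->]; apply: fAB.
- move=> _ _ /imsetP[y yC ->] /imsetP[z zC ->].
  by case/orP: (C_chain y z yC zC) => /f_homo le_f; apply/orP; [left|right];
    apply: le_f; apply: CA.
Qed.

Lemma homotopic_comparable (f g : P -> Q) :
  order_map A B f -> order_map A B g ->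
  (forall x y, x \in A -> y \in A -> x >=< y -> f x >=< g y) ->
  homotopic R (realization R (order_complex A)) (realization R (order_complex B))
    (pushforward f) (pushforward g).
Proof.
move=> fAB gAB fg; apply: homotopic_contiguous => C CA; try exact: order_map_chain.
have /order_complexP[fC0 fCB f_chain] := order_map_chain fAB CA.
have /order_complexP[_ gCB g_chain] := order_map_chain gAB CA.
have /order_complexP[_ /fintype.subsetP CsubA C_chain] := CA.
have fgC x y : x \in C -> y \in C -> f x >=< g y.
  by move=> xC yC; apply: fg; [exact: CsubA|exact: CsubA|exact: C_chain].
apply/order_complexP; split.
- by apply: contraNneq fC0 => /eqP; rewrite finset.setU_eq0 => /andP[].
- by rewrite finset.subUset fCB.
- move=> x y /finset.setUP[xf|xg] /finset.setUP[yf|yg].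
  + exact: f_chain.
  + by case/imsetP: xf yg => x' x'C -> /imsetP[y' y'C ->]; apply: fgC.
  + by case/imsetP: xg yf => x' x'C -> /imsetP[y' y'C ->]; rewrite comparable_sym fgC.
  + exact: g_chain.
Qed.

Variables f g : P -> Q.
Hypotheses (f_map : order_map A B f) (g_map : order_map A B g).
Hypothesis f_le_g : {in A, forall x, f x <= g x}.

Definition rank (x : P) : nat := #|[set y | y < x]%SET|.

(* Switching from [f] to [g] one rank at a time, from the top of [P] down, makes
   consecutive maps contiguous: a chain meets each rank at most once. *)
Definition switch (k : nat) (x : P) : Q := if (k <= rank x)%N then g x else f x.

Lemma rank_lt x y : x < y -> (rank x < rank y)%N.
Proof.
move=> xy; apply: proper_card; apply/properP; split.
  by apply/fintype.subsetP => z; rewrite !inE => /lt_trans; apply.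
by exists x; rewrite !inE ?ltxx.
Qed.

Lemma switch_le k l x y : x \in A -> y \in A -> x < y -> (l <= k.+1)%N ->
  switch k x <= switch l y.
Proof.
have [[_ f_homo] [_ g_homo]] := (f_map, g_map).
move=> xA yA xy lk; rewrite /switch; have [kx|_] := leqP k (rank x).
  by rewrite (leq_trans lk (leq_ltn_trans kx (rank_lt xy))) g_homo // ltW.
have fxy : f x <= f y by apply: f_homo => //; apply: ltW.
by case: ifP => // _; apply: le_trans fxy (f_le_g yA).
Qed.

Lemma order_map_switch k : order_map A B (switch k).
Proof.
have [[fAB _] [gAB _]] := (f_map, g_map).
split=> [x xA|x y xA yA]; first by rewrite /switch; case: ifP => _; auto.
by rewrite le_eqVlt => /predU1P[->//|/switch_le]; apply.
Qed.

Lemma switchS_comparable k x y :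
  x \in A -> y \in A -> x >=< y -> switch k.+1 x >=< switch k y.
Proof.
move=> xA yA; have [<- _|neq_xy] := eqVneq x y.
  apply/orP; left; rewrite /switch; have [/ltnW->//|_] := ltnP k (rank x).
  by case: ifP => // _; apply: f_le_g.
case/orP; rewrite le_eqVlt 1?(eq_sym y) (negbTE neq_xy) /= => lt_xy.
  by apply/orP; left; apply: switch_le; rewrite // leqW.
by apply/orP; right; apply: switch_le.
Qed.

Lemma homotopic_order_map :
  homotopic R (realization R (order_complex A)) (realization R (order_complex B))
    (pushforward f) (pushforward g).
Proof.
rewrite (_ : f = switch #|P|.+1); last first.
  by apply: funext => x; rewrite /switch ifF // leqNgt ltnS max_card.
elim: #|P|.+1 => [|k IHk].
  apply/homotopic_refl/continuous_map_pushforward => C.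
  exact: (order_map_chain g_map).
apply: homotopic_trans IHk; apply: homotopic_comparable;
  by [exact: order_map_switch|exact: order_map_switch|exact: switchS_comparable].
Qed.

End OrderComplexes.

Lemma galois_homotopy_equivalent (R : realType) (d d' : Order.disp_t)
    (P : finPOrderType d) (Q : finPOrderType d') (A : {set P}) (B : {set Q})
    (f : P -> Q) (g : Q -> P) :
  order_map A B f -> order_map B A g ->
  {in A, forall x, (x <= g (f x))%O} -> {in B, forall y, (f (g y) <= y)%O} ->
  homotopy_equivalent R (realization R (order_complex A))
    (realization R (order_complex B)).
Proof.
move=> fAB gBA gf fg; exists (pushforward f), (pushforward g); split.
- by apply: continuous_map_pushforward => C; apply: order_map_chain.
- by apply: continuous_map_pushforward => C; apply: order_map_chain.
- rewrite -pushforward_comp -[X in homotopic _ _ _ _ X]pushforward_id.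
  apply: homotopic_sym.
  exact: (homotopic_order_map (order_map_id A) (order_map_comp fAB gBA) gf).
- rewrite -pushforward_comp -[X in homotopic _ _ _ _ X]pushforward_id.
  exact: (homotopic_order_map (order_map_comp gBA fAB) (order_map_id B) fg).
Qed.

(** * The proper part of a finite Boolean lattice is a sphere *)

Local Notation powerset_complex I := (order_complex (proper_part {set I})).

Section Levels.
Local Open Scope ring_scope.
Local Open Scope classical_set_scope.
Context {R : realType} {I : finType}.
Implicit Types (s : I -> R) (S T : {set I}) (t : {ptws {set I} -> R}).

Definition nonconstant s : Prop := exists i j, s i < s j.

Definition superlevel s S : Prop := forall i j, i \in S -> j \notin S -> s j < s i.

Definition level t : {ptws I -> R} := fun i => \sum_(S : {set I} | i \in S) t S.

(* Any weight would do that depends continuously on [s] and is positive exactly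
   at the proper nonempty superlevel sets of [s]. *)
Definition weight s S : R :=
  if S \in proper_part {set I}
  then \prod_(i in S) \prod_(j in ~: S) Num.max 0 (s i - s j) else 0.

Definition superlevel_point s : {ptws {set I} -> R} :=
  fun S => weight s S / \sum_(T : {set I}) weight s T.

Lemma proper_setP S : reflect
  ((exists i, i \in S) /\ exists j, j \notin S) (S \in proper_part {set I}).
Proof.
rewrite inE; apply: (iffP andP) => [[/finset.set0Pn[i iS] ST]|[[i iS] [j jS]]].
  split; first by exists i.
  by move: ST; rewrite -finset.subTset => /subsetPn[j _ jS]; exists j.
split; first by apply/finset.set0Pn; exists i.
by apply: contraNneq jS => ->; rewrite finset.in_setT.
Qed.

Lemma superlevel_nonconstant s S :
  S \in proper_part {set I} -> superlevel s S -> nonconstant s.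
Proof. by move=> /proper_setP[[i iS] [j jS]] sS; exists j, i; apply: sS. Qed.

Lemma superlevel_comparable s S T :
  superlevel s S -> superlevel s T -> (S >=< T)%O.
Proof.
move=> sS sT; have [ST|/subsetPn[i iS iT]] := boolP (S \subset T).
  by apply/orP; left.
apply/orP; right; apply/fintype.subsetP => j jT; apply: contraT => jS.
by have := lt_trans (sS i j iS jS) (sT j i jT iT); rewrite ltxx.
Qed.

Lemma superlevel_segment s s' S a : 0 <= a <= 1 ->
  superlevel s S -> superlevel s' S -> superlevel (segment s s' a) S.
Proof.
move=> /andP[a0 a1] sS s'S i j iS jS; rewrite /segment.
have sij := sS i j iS jS; have s'ij := s'S i j iS jS.
have [->|a_neq0] := eqVneq a 0; first by rewrite subr0 !mul1r !mul0r !addr0.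
have a_gt0 : 0 < a by rewrite lt_def a_neq0.
by rewrite ler_ltD ?ltr_pM2l // ler_wpM2l ?subr_ge0 // ltW.
Qed.

Lemma weight_ge0 s S : 0 <= weight s S.
Proof.
rewrite /weight; case: ifP => // _; rewrite prodr_ge0 // => i _.
by rewrite prodr_ge0 // => j _; rewrite le_max lexx.
Qed.

Lemma weight_neq0P s S : reflect
  (S \in proper_part {set I} /\ superlevel s S) (weight s S != 0).
Proof.
rewrite /weight; case: ifP => Sp; last by rewrite eqxx; constructor; case.
have maxE i j : (Num.max 0 (s i - s j) != 0) = (s j < s i).
  by rewrite -subr_gt0; case: ltP => [/gt_eqF->|]; rewrite ?eqxx.
apply: (iffP (prodf_neq0 _ _)) => [w|[_ sS] i iS].
  split=> // i j iS jS; rewrite -maxE.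
  by have /prodf_neq0/(_ j) := w i iS; rewrite finset.in_setC => ->.
by apply/prodf_neq0 => j; rewrite finset.in_setC maxE; apply: sS.
Qed.

Lemma sum_weight_gt0 s : nonconstant s -> 0 < \sum_(S : {set I}) weight s S.
Proof.
move=> [i [j ij]]; pose S := [set k | s i < s k]%SET.
have wS : weight s S != 0.
  apply/weight_neq0P; split; last first.
    by move=> k l; rewrite !inE -leNgt => ik li; apply: le_lt_trans ik.
  by apply/proper_setP; split; [exists j|exists i]; rewrite inE ?ltxx.
rewrite (bigD1 S) //= ltr_pwDl ?sumr_ge0 // ?lt_def ?wS ?weight_ge0 //.
by move=> T _; apply: weight_ge0.
Qed.

Lemma carrier_superlevel_point s S : S \in carrier (superlevel_point s) ->
  S \in proper_part {set I} /\ superlevel s S.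
Proof.
rewrite inE => St; apply/weight_neq0P; apply: contraNneq St => w0.
by rewrite /superlevel_point w0 mul0r.
Qed.

Lemma superlevel_chain s (C : {set {set I}}) : C != finset.set0 ->
  (forall S, S \in C -> S \in proper_part {set I} /\ superlevel s S) ->
  C \in powerset_complex I.
Proof.
move=> C0 CP; apply/order_complexP; split=> //.
  by apply/fintype.subsetP => S /CP[].
by move=> S T /CP[_ sS] /CP[_ sT]; apply: superlevel_comparable sS sT.
Qed.

Lemma realization_superlevel_point s : nonconstant s ->
  realization R (powerset_complex I) (superlevel_point s).
Proof.
move=> /sum_weight_gt0 w_gt0.
have sum1 : \sum_S superlevel_point s S = 1 by rewrite -mulr_suml divff // gt_eqF.
split=> //.
  by move=> S; rewrite divr_ge0 ?weight_ge0 // ltW.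
apply: (superlevel_chain (s := s)) => [|S]; last exact: carrier_superlevel_point.
exact: carrier_neq0.
Qed.

Lemma superlevel_level t S :
  realization R (powerset_complex I) t -> S \in carrier t -> superlevel (level t) S.
Proof.
move=> [t0 _ /order_complexP[_ _ t_chain]] St i j iS jS.
have tS : 0 < t S by move: St; rewrite inE lt_def t0 andbT.
rewrite /level [ltRHS](bigD1 S) //= ltr_pwDl // big_mkcond [leRHS]big_mkcond /=.
apply: ler_sum => T _; have [jT|_] := ifP; last by case: ifP.
have [->|tT] := eqVneq (t T) 0; first by case: ifP.
have TS : T != S by apply: contraNneq jS => <-.
have ST : S \subset T.
  have /orP[//|/fintype.subsetP TS'] : (S >=< T)%O by apply: t_chain St _; rewrite inE.
  by rewrite TS' in jS.
by rewrite (fintype.subsetP ST) ?TS.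
Qed.

Lemma nonconstant_level t :
  realization R (powerset_complex I) t -> nonconstant (level t).
Proof.
move=> tK; have [_ t1 _] := tK; have [S St] := finset.set0Pn _ (carrier_neq0 t1).
apply: superlevel_nonconstant (superlevel_level tK St).
by have [_ _ /order_complexP[_ /fintype.subsetP t_proper _]] := tK; apply: t_proper.
Qed.

Lemma continuous_level : continuous level.
Proof.
move=> t; apply: continuous_ptws => i; apply: continuous_sum => S _.
exact: (@continuous_eval _ _ _ _ id).
Qed.

Lemma continuous_weight (X : topologicalType) (p : X) (f : X -> I -> R) S :
  (forall i, {for p, continuous (f ^~ i)}) ->
  {for p, continuous (fun q => weight (f q) S)}.
Proof.
move=> cf; rewrite /weight; case: (S \in proper_part {set I}); last exact: cvg_cst.
apply: continuous_prod => i _; apply: continuous_prod => j _.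
by apply: continuous_maxr0; apply: cvgB; apply: cf.
Qed.

Lemma continuous_superlevel_point (X : topologicalType) (p : X)
    (f : X -> {ptws I -> R}) :
  nonconstant (f p) -> {for p, continuous f} ->
  {for p, continuous (fun q => superlevel_point (f q))}.
Proof.
move=> /sum_weight_gt0 w_gt0 cf; apply: continuous_ptws => S.
have cweight T : {for p, continuous (fun q => weight (f q) T)}.
  by apply: continuous_weight => i; apply: continuous_eval.
apply: cvgM; first exact: cweight.
by apply: cvgV; [rewrite gt_eqF|exact: continuous_sum].
Qed.

End Levels.

Section Sphere.
Local Open Scope ring_scope.
Local Open Scope classical_set_scope.
Context {R : realType} {n : nat}.
Implicit Types v : 'rV[R]_n.

Definition l2norm v : R := Num.sqrt (\sum_k v ord0 k ^+ 2).

Definition normalize v : 'rV[R]_n := (l2norm v)^-1 *: v.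

Lemma l2norm_gt0 v : (0 < l2norm v) = (v != 0).
Proof.
have sq_ge0 (k : 'I_n) : true -> 0 <= v ord0 k ^+ 2 by move=> _; apply: sqr_ge0.
rewrite sqrtr_gt0 lt_def sumr_ge0 // andbT psumr_neq0 //.
apply/hasP/rV0Pn => [[k _ vk]|[k vk]]; exists k; rewrite ?mem_index_enum //.
  by move: vk; rewrite /= lt_def sqrf_eq0 => /andP[].
by rewrite /= lt_def sqrf_eq0 vk sqr_ge0.
Qed.

Lemma unit_sphere_normalize v : v != 0 -> unit_sphere (normalize v).
Proof.
rewrite -l2norm_gt0 => v_gt0; rewrite /unit_sphere /=.
under eq_bigr do rewrite mxE exprMn.
rewrite -mulr_sumr -[X in _ * X]sqr_sqrtr ?sumr_ge0 //; last first.
  by move=> k _; apply: sqr_ge0.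
by rewrite -exprMn mulVf ?expr1n // gt_eqF.
Qed.

Lemma normalize_unit_sphere v : unit_sphere v -> normalize v = v.
Proof. by rewrite /normalize /l2norm => ->; rewrite sqrtr1 invr1 scale1r. Qed.

Lemma unit_sphere_neq0 v : unit_sphere v -> v != 0.
Proof.
apply: contraPneq => ->; rewrite /unit_sphere /= big1 => [/eqP|k _].
  by rewrite eq_sym oner_eq0.
by rewrite mxE expr0n.
Qed.

Lemma continuous_l2norm : continuous l2norm.
Proof.
move=> v; apply: (@continuous_comp _ _ _ (fun v : 'rV[R]_n => \sum_k v ord0 k ^+ 2)).
  apply: continuous_sum => k _.
  have ck : {for v, continuous (fun w : 'rV[R]_n => w ord0 k)}.
    exact: coord_continuous.
  exact: (cvgM ck ck).
exact: sqrt_continuous.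
Qed.

Lemma continuous_normalize v : v != 0 -> {for v, continuous normalize}.
Proof.
rewrite -l2norm_gt0 => /gt_eqF/negbT v_neq0.
exact: (cvgZ (cvgV v_neq0 (@continuous_l2norm v)) cvg_id).
Qed.

Lemma homotopic_unit_sphere (X : topologicalType) (A : set X) (f g : X -> 'rV[R]_n) :
  continuous_map A (@unit_sphere R n) f -> continuous_map A (@unit_sphere R n) g ->
  (forall x a, A x -> 0 <= a <= 1 -> (1 - a) *: f x + a *: g x != 0) ->
  homotopic R A (@unit_sphere R n) f g.
Proof.
move=> fS gS fg_neq0.
exists (fun p => normalize ((1 - p.2) *: f p.1 + p.2 *: g p.1)); split.
- rewrite continuous_subspace_in => p /set_mem[Ap].
  rewrite /= in_itv /= => p01.
  have [cf1 _] := continuous_map_comp (@continuous_map_fst R X A) fS.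
  have [cg1 _] := continuous_map_comp (@continuous_map_fst R X A) gS.
  have c2 : {for p, continuous (snd : subspace (cylinder A) -> R)}.
    by apply: continuous_subspaceT => q; apply: cvg_snd.
  apply: (@continuous_comp (subspace (cylinder A)) _ _
    (fun q => (1 - q.2) *: f q.1 + q.2 *: g q.1)); last first.
    exact/continuous_normalize/fg_neq0.
  apply: cvgD; apply: cvgZ; [|exact: cf1|exact: c2|exact: cg1].
  by apply: cvgB; [exact: cvg_cst|exact: c2].
- move=> [x a] [/= Ax]; rewrite in_itv /= => a01.
  exact/unit_sphere_normalize/fg_neq0.
- move=> x Ax /=; rewrite subr0 scale1r scale0r addr0.
  exact/normalize_unit_sphere/fS.2.
- move=> x Ax /=; rewrite subrr scale1r scale0r add0r.
  exact/normalize_unit_sphere/gS.2.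
Qed.

End Sphere.

Section Boolean.
Local Open Scope ring_scope.
Local Open Scope classical_set_scope.
Context {R : realType} {n : nat}.
Implicit Types (v w : 'rV[R]_n) (s : 'I_n.+1 -> R).

(* Functions on ['I_n.+1] modulo constants, in coordinates. *)
Definition difference s : 'rV[R]_n := \row_k (s (lift ord0 k) - s ord0).

Definition undifference v : {ptws 'I_n.+1 -> R} :=
  fun i => if unlift ord0 i is Some k then v ord0 k else 0.

Lemma undifference_difference s i : undifference (difference s) i = s i - s ord0.
Proof.
by rewrite /undifference; case: unliftP => [k ->|->]; rewrite ?mxE ?subrr.
Qed.

Lemma undifferenceZ a v i : undifference (a *: v) i = a * undifference v i.
Proof. by rewrite /undifference; case: unlift => [k|]; rewrite ?mxE ?mulr0. Qed.

Lemma undifference_segment a v w :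
  undifference ((1 - a) *: v + a *: w) =
    segment (undifference v) (undifference w) a.
Proof.
apply: funext => i; rewrite /segment /undifference.
by case: unlift => [k|]; rewrite ?mxE // !mulr0 addr0.
Qed.

Lemma nonconstant_undifference v : nonconstant (undifference v) <-> v != 0.
Proof.
split=> [[i [j]]|/rV0Pn[k vk]].
  apply: contraTneq => ->; rewrite /undifference -leNgt.
  by case: unlift => [k|]; case: unlift => [l|]; rewrite ?mxE.
have [vk0|vk0|vk0] := ltgtP (v ord0 k) 0; last by rewrite vk0 eqxx in vk.
  by exists (lift ord0 k), ord0; rewrite /undifference liftK unlift_none.
by exists ord0, (lift ord0 k); rewrite /undifference liftK unlift_none.
Qed.

Lemma difference_neq0 s : nonconstant s -> difference s != 0.
Proof.
move=> [i [j ij]]; apply/nonconstant_undifference; exists i, j.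
by rewrite !undifference_difference ltrD2r.
Qed.

Lemma superlevel_undifference_normalize s S : nonconstant s ->
  superlevel (undifference (normalize (difference s))) S <-> superlevel s S.
Proof.
move=> /difference_neq0; rewrite -l2norm_gt0 => s_gt0.
have lt_s i j : (undifference (normalize (difference s)) j <
    undifference (normalize (difference s)) i) = (s j < s i).
  by rewrite !undifferenceZ !undifference_difference ltr_pM2l ?invr_gt0 // ltrD2r.
by split=> sS i j iS jS; have := sS i j iS jS; rewrite lt_s.
Qed.

Lemma continuous_difference (X : topologicalType) (p : X)
    (f : X -> {ptws 'I_n.+1 -> R}) :
  {for p, continuous f} -> {for p, continuous (fun q => difference (f q))}.
Proof.
move=> cf W /= [B hB BW]; apply: filterS BW _.
apply: filter_forall => i; apply: filter_forall => k.
have cfk : {for p, continuous (fun q => difference (f q) i k)}.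
  have -> : (fun q => difference (f q) i k) = fun q => f q (lift ord0 k) - f q ord0.
    by apply: funext => q; rewrite mxE.
  by apply: cvgB; apply: continuous_eval.
exact/cfk/hB.
Qed.

Lemma continuous_undifference (X : topologicalType) (p : X) (f : X -> 'rV[R]_n) :
  {for p, continuous f} -> {for p, continuous (fun q => undifference (f q))}.
Proof.
move=> cf; apply: continuous_ptws => i; rewrite /undifference.
case: unlift => [k|]; last exact: cvg_cst.
apply: (@continuous_comp _ _ _ f (fun v : 'rV[R]_n => v ord0 k)) => //.
exact: coord_continuous.
Qed.

Local Notation boolean_sphere := (realization R (powerset_complex 'I_n.+1)).

Definition to_sphere (t : {ptws {set 'I_n.+1} -> R}) : 'rV[R]_n :=
  normalize (difference (level t)).

Definition of_sphere v : {ptws {set 'I_n.+1} -> R} :=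
  superlevel_point (undifference v).

Lemma continuous_map_to_sphere :
  continuous_map boolean_sphere (@unit_sphere R n) to_sphere.
Proof.
split=> [|t /nonconstant_level/difference_neq0]; last exact: unit_sphere_normalize.
apply: continuous_in_subspaceT => t /set_mem/nonconstant_level/difference_neq0 t0.
apply: (@continuous_comp _ _ _ (fun t => difference (level t))).
  exact/continuous_difference/continuous_level.
exact: continuous_normalize.
Qed.

Lemma continuous_map_of_sphere :
  continuous_map (@unit_sphere R n) boolean_sphere of_sphere.
Proof.
have v_nonconstant v : unit_sphere v -> nonconstant (undifference v).
  by move=> /unit_sphere_neq0/nonconstant_undifference.
split=> [|v /v_nonconstant]; last exact: realization_superlevel_point.
apply: continuous_in_subspaceT => v /set_mem/v_nonconstant v_nc.
apply: continuous_superlevel_point => //.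
exact: (@continuous_undifference _ _ id).
Qed.

Lemma superlevel_to_sphere t S : boolean_sphere t -> S \in carrier t ->
  superlevel (undifference (to_sphere t)) S.
Proof.
move=> tK St; apply/superlevel_undifference_normalize; first exact: nonconstant_level.
exact: superlevel_level.
Qed.

Lemma homotopic_of_sphere_to_sphere :
  homotopic R boolean_sphere boolean_sphere (of_sphere \o to_sphere) id.
Proof.
apply: homotopic_segment.
- exact: continuous_map_comp continuous_map_to_sphere continuous_map_of_sphere.
- by split=> //; apply: continuous_subspaceT => t; apply: cvg_id.
- move=> t tK; have [_ t1 /order_complexP[_ /fintype.subsetP t_proper _]] := tK.
  apply: (superlevel_chain (s := undifference (to_sphere t))) => [|S].
    by rewrite finset.setU_eq0 negb_and (carrier_neq0 t1) orbT.
  case/finset.setUP => [/carrier_superlevel_point//|St].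
  by split; [exact: t_proper|exact: superlevel_to_sphere].
Qed.

Lemma homotopic_to_sphere_of_sphere :
  homotopic R (@unit_sphere R n) (@unit_sphere R n) (to_sphere \o of_sphere) id.
Proof.
apply: homotopic_unit_sphere.
- exact: continuous_map_comp continuous_map_of_sphere continuous_map_to_sphere.
- by split=> //; apply: continuous_subspaceT => v; apply: cvg_id.
- move=> v a /continuous_map_of_sphere.2 tK a01; apply/nonconstant_undifference.
  have [_ t1 _] := tK; have [S St] := finset.set0Pn _ (carrier_neq0 t1).
  have [S_proper vS] := carrier_superlevel_point St.
  apply: (superlevel_nonconstant S_proper).
  rewrite undifference_segment.
  exact: superlevel_segment a01 (superlevel_to_sphere tK St) vS.
Qed.

End Boolean.

Lemma powerset_realization0 (R : realType) :
  realization R (powerset_complex 'I_0) = classical_sets.set0.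
Proof.
rewrite -subset0 => t [_ /carrier_neq0/finset.set0Pn[S St]].
case/order_complexP=> _ /fintype.subsetP/(_ S St)/proper_setP[[i _] _] _.
by case: i.
Qed.

Lemma unit_sphere0 (R : realType) : @unit_sphere R 0 = classical_sets.set0.
Proof.
rewrite -subset0 => v; rewrite /unit_sphere /= big_ord0 => /esym/eqP.
by rewrite oner_eq0.
Qed.

Lemma spherical_powerset (R : realType) (n : nat) : spherical R {set 'I_n}.
Proof.
case: n => [|n]; [exists 0|exists n].
  rewrite powerset_realization0 unit_sphere0.
  by apply: homotopy_equivalent_set0; [exact: (fun=> 0%R)|exact: 0%R].
exists to_sphere, of_sphere; split.
- exact: continuous_map_to_sphere.
- exact: continuous_map_of_sphere.
- exact: homotopic_of_sphere_to_sphere.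
- exact: homotopic_to_sphere_of_sphere.
Qed.

(** * Boolean crosscuts *)

Section Crosscut.
Local Open Scope order_scope.
Context {R : realType} {d : Order.disp_t} (P : finTBLatticeType d).
Context (I : finType) (e : I -> P).
Implicit Types (x y : P) (S : {set I}).

Hypothesis e_cofinal : forall x, x != \top -> exists i, x <= e i.
Hypothesis meet_e : \meet_i e i = \bot.
Hypothesis meet_e_le : forall S i, (\meet_(k in S) e k <= e i) = (i \in S).

Definition not_below x : {set I} := [set i | ~~ (x <= e i)]%SET.

Definition meet_compl S : P := \meet_(i in ~: S) e i.

Lemma meet_complK : cancel meet_compl not_below.
Proof. by move=> S; apply/setP => i; rewrite !inE meet_e_le inE negbK. Qed.

Lemma le_meet_compl_not_below x : x <= meet_compl (not_below x).
Proof. by apply/meetsP => i; rewrite !inE negbK. Qed.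

Lemma order_map_not_below :
  order_map (proper_part P) (proper_part {set I}) not_below.
Proof.
split=> [x|x y _ _ xy]; last first.
  by apply/fintype.subsetP => i; rewrite !inE; apply/contra/le_trans.
rewrite inE => /andP[x_neq0 x_neq1]; apply/proper_setP; split; last first.
  by have [i xi] := e_cofinal x_neq1; exists i; rewrite inE negbK.
apply/existsP; apply: contra_neqT x_neq0 => /existsPn x_le.
apply/eqP; rewrite -lex0 -meet_e; apply/meetsP => i _.
by have := x_le i; rewrite inE negbK.
Qed.

Lemma order_map_meet_compl :
  order_map (proper_part {set I}) (proper_part P) meet_compl.
Proof.
split=> [S /proper_setP[[i iS] [j jS]]|S T _ _ ST]; last first.
  apply/meetsP => i iT; apply: meets_inf; move: iT; rewrite !inE.
  exact/contra/(fintype.subsetP ST).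
rewrite -(meet_complK S) in iS jS; rewrite inE; apply/andP; split.
  by apply: contraTneq iS => ->; rewrite inE negbK le0x.
apply: contraNneq jS => ->; rewrite inE; apply/negP => j1.
by have := meet_e_le finset.set0 j; rewrite finset.in_set0 (le_trans (lex1 _) j1).
Qed.

Lemma crosscut_homotopy_equivalent :
  homotopy_equivalent R (realization R (order_complex (proper_part P)))
    (realization R (powerset_complex I)).
Proof.
apply: (galois_homotopy_equivalent _ order_map_not_below order_map_meet_compl).
  by move=> x _; apply: le_meet_compl_not_below.
by move=> S _; rewrite meet_complK.
Qed.

End Crosscut.

Lemma spherical_boolean_coatoms (R : realType) (d : Order.disp_t)
    (L : finTBLatticeType d) :
  nucleus (\top : L)%O = \bot%O ->
  (forall (S : {set L}) c, {in S, forall k, covers k \top%O} -> covers c \top%O ->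
    (\meet_(k in S) k <= c)%O = (c \in S)) ->
  spherical R L.
Proof.
move=> nucleus_bot coatoms_indep; pose coatoms := [set c : L | covers c \top%O]%SET.
pose e (i : 'I_#|coatoms|) : L := enum_val i.
have e_coatom i : covers (e i) \top%O by have := enum_valP i; rewrite inE.
have e_onto c : covers c \top%O -> exists i, e i = c.
  move=> cc; have cC : c \in coatoms by rewrite inE.
  by exists (enum_rank_in cC c); apply: enum_rankK_in.
have [n sphere_n] := spherical_powerset R #|coatoms|.
exists n; apply: homotopy_equivalent_trans sphere_n.
apply: (@crosscut_homotopy_equivalent R d L _ e) => [x||S i].
- by rewrite -ltx1 => /covers_above[c /e_onto[i <-] xi]; exists i.
- apply/eqP; rewrite -lex0 -nucleus_bot; apply/meetsP => c /e_onto[i <-].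
  exact: meets_inf.
- rewrite -(mem_imset _ _ (@enum_val_inj _ coatoms)) -coatoms_indep //.
    by rewrite (big_imset (fun k => k) (in2W (@enum_val_inj _ coatoms))).
  by move=> _ /imsetP[k _ ->].
Qed.

Theorem theorem1p1 (R : realType) (d : Order.disp_t) (L : finTBLatticeType d) :
  congruence_uniform L -> is_lattice (@clo d L) -> spherical R L.
Proof.
move=> [[cg_irr_inj _] _] clo_lattice; apply: spherical_boolean_coatoms.
  exact: nucleus_top cg_irr_inj clo_lattice.
exact: coatoms_meet_le cg_irr_inj.
Qed.
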